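(* Let $\mathbf{A}$ be a finite lattice algebra, let $\tau$ be a finite relational vocabulary, and for each $R\in\tau$ let $p_R\colon A\to[0,1]$ be a probability distribution with $p_R(a)>0$ for every $a\in A$. Then for every sentence $\varphi$ of $\mathcal{L}^{\mathbf{A}}(\tau)$ and every $a\in A$, either $\lim_{n\to\infty}\mu_n(\varphi=a)=1$ or $\lim_{n\to\infty}\mu_n(\varphi=a)=0$. Equivalently, for every sentence $\varphi$ of $\mathcal{L}^{\mathbf{A}}(\tau)$ there is a unique $a\in A$ such that $\lim_{n\to\infty}\mu_n(\varphi=a)=1$.
   Context: A lattice algebra is an algebra $\mathbf{A}=\langle A,\wedge,\vee,\dots\rangle$ with a lattice reduct $\langle A,\wedge,\vee\rangle$ and possibly further finitary operations. For a relational vocabulary $\tau$ (each $R\in\tau$ has an arity $\tau(R)$), the formulas of $\mathcal{L}^{\mathbf{A}}(\tau)$ are built from atomic formulas $R(x_1,\dots,x_{\tau(R)})$ using one connective for each operation of $\mathbf{A}$ and the quantifiers $\forall,\exists$. An $\mathbf{A}$-valued $\tau$-structure $\mathfrak{M}$ has a nonempty domain $M$ and maps $R^{\mathfrak{M}}\colon M^{\tau(R)}\to A$; the value $\|\varphi\|^{\mathfrak{M}}(m_1,\dots,m_k)\in A$ is defined inductively, interpreting atomic formulas by $\mathfrak{M}$, connectives by the operations of $\mathbf{A}$, $\forall$ as infimum and $\exists$ as supremum in the lattice. Let $\mathrm{Mod}^{\mathbf{A}}_{\tau,n}$ be the (finite) set of $\mathbf{A}$-valued $\tau$-structures with domain $[n]=\{1,\dots,n\}$,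 and define $\Pr_n(\mathfrak{M})=\prod\{p_R(R^{\mathfrak{M}}(i_1,\dots,i_{\tau(R)})) : R\in\tau,\ i_1,\dots,i_{\tau(R)}\in[n]\}$. For a sentence $\varphi$ and $a\in A$, $\mu_n(\varphi=a)=\sum\{\Pr_n(\mathfrak{M}) : \mathfrak{M}\in\mathrm{Mod}^{\mathbf{A}}_{\tau,n},\ \|\varphi\|^{\mathfrak{M}}=a\}$.
   Formalization: Every relation symbol of τ is required to have arity at least 1; with a nullary symbol S and |A| ≥ 2 the claim fails, since μ_n(S = a) = p_S(a) lies strictly between 0 and 1 for every n. *)

(* Defs.v *)
From HB Require Import structures.
From mathcomp Require Import all_boot all_order all_algebra.
From mathcomp Require Import boolp classical_sets reals topology normedtype.

Set Implicit Arguments.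
Unset Strict Implicit.
Unset Printing Implicit Defensive.

Import Order.TTheory GRing.Theory Num.Theory.
Import numFieldNormedType.Exports.

Local Open Scope ring_scope.

(* A finTBLatticeType is an arbitrary nonempty finite lattice; its top and
   bottom are not connectives unless some la_op denotes them. *)
Record finLatticeAlgebra (d : Order.disp_t) := FinLatticeAlgebra {
  la_lattice :> finTBLatticeType d;
  la_op : Type;
  la_arity : la_op -> nat;
  la_fun : forall o : la_op, (la_arity o).-tuple la_lattice -> la_lattice
}.

(* Relation symbols have positive arity: a nullary symbol S would satisfy
   mu_n(S = a) = p_S(a) for all n, and there would be no zero-one law. *)
Record finVocabulary := FinVocabulary {
  voc_rel :> finType;
  voc_arity : voc_rel -> nat;
  voc_arity_gt0 : forall S : voc_rel, (0 < voc_arity S)%N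
}.

Section Logic.
Variables (d : Order.disp_t) (A : finLatticeAlgebra d) (tau : finVocabulary).

(* formula k: formulas with free variables among k de Bruijn variables;
   a quantifier binds variable 0 of its body. *)
Inductive formula : nat -> Type :=
| Atom k (S : tau) (x : (voc_arity S).-tuple 'I_k) : formula k
| And k (f g : formula k) : formula k
| Or k (f g : formula k) : formula k
| Op k (o : la_op A) (f : 'I_(la_arity o) -> formula k) : formula k
| Forall k (f : formula k.+1) : formula k
| Exists k (f : formula k.+1) : formula k.

Definition sentence := formula 0.

Definition structure (D : finType) :=
  {dffun forall S : tau, {ffun (voc_arity S).-tuple D -> A}}.

(* The infimum and supremum over a nonempty D are iterated meets and joins. *)
Fixpoint value (D : finType) (M : structure D) (k : nat) (f : formula k) :
    k.-tuple D -> A :=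
  match f in formula k return k.-tuple D -> A with
  | Atom _ r x => fun m => M r [tuple of map (tnth m) x]
  | And _ f g => fun m => (value M f m `&` value M g m)%O
  | Or _ f g => fun m => (value M f m `|` value M g m)%O
  | Op _ o f => fun m => la_fun [tuple value M (f i) m | i < la_arity o]
  | Forall _ f => fun m => (\meet_(b : D) value M f [tuple of b :: m])%O
  | Exists _ f => fun m => (\join_(b : D) value M f [tuple of b :: m])%O
  end.

Section Probability.
Variables (R : realType) (p : tau -> A -> R).

Definition is_distribution (q : A -> R) :=
  (forall a, 0 <= q a <= 1) /\ \sum_(a : A) q a = 1.

Definition prob (n : nat) (M : structure 'I_n) : R :=
  \prod_(S : tau) \prod_(i : (voc_arity S).-tuple 'I_n) p S (M S i).

Definition mu (n : nat) (phi : sentence) (a : A) : R :=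
  \sum_(M : structure 'I_n | value M phi [tuple] == a) prob M.

End Probability.
End Logic.

(* Main.v *)
Require Import Defs.
From HB Require Import structures.
From mathcomp Require Import all_boot all_order all_algebra.
From mathcomp Require Import boolp classical_sets reals topology normedtype.
From mathcomp Require Import sequences exp.

(* Fix K. A structure is called saturated if, for every tuple c of fewer than K
   points, every assignment T of values to the ground atoms that mention a new
   point and otherwise only points of c is realized by some point outside c. A
   back-and-forth argument shows that all saturated structures give the same
   value to a sentence of quantifier rank at most K. In a random structure on n
   points, the points outside a tuple of length j realize T independently, each
   with probability at least some q > 0, so T fails to be realized with
   probability at most (1 - q)^(n - j). There are O(n^j) pairs (c, T) to
   consider, hence the structure is saturated with probability tending to 1, and
   the value common to all saturated structures is almost sure. *)

Set Implicit Arguments.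
Unset Strict Implicit.
Unset Printing Implicit Defensive.

Import Order.TTheory GRing.Theory Num.Theory.
Import numFieldNormedType.Exports.

Local Open Scope classical_set_scope.
Local Open Scope ring_scope.

Lemma tnth_eqF (X : eqType) k (t : k.-tuple X) x i :
  x \notin t -> (tnth t i == x) = false.
Proof. by apply: contraNF => /eqP<-; exact: mem_tnth. Qed.

Lemma eq_big_codom (X : eqType) (idx : X) (op : Monoid.com_law idx)
    (I J : finType) (F : I -> X) (G : J -> X) :
  idempotent_op op -> codom F =i codom G ->
  \big[op/idx]_i F i = \big[op/idx]_j G j.
Proof.
move=> opxx /(eq_big_idem predT id opxx).
by rewrite !(big_image op idx _ predT id).
Qed.

Lemma sum_not_forall_le (R : numDomainType) (X I : finType) (w : X -> R)
    (Q : I -> pred X) :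
  (forall x, 0 <= w x) ->
  \sum_(x | ~~ [forall i, Q i x]) w x <= \sum_i \sum_(x | ~~ Q i x) w x.
Proof.
move=> w0; under [leRHS]eq_bigr => i _ do rewrite big_mkcond.
rewrite exchange_big [leLHS]big_mkcond; apply: ler_sum => x _ /=.
have wQ0 i : 0 <= (if ~~ Q i x then w x else 0) by case: ifP.
case: ifP => [|_]; last exact: sumr_ge0.
rewrite negb_forall => /existsP[i nQix].
by rewrite (bigD1 i) //= nQix lerDl sumr_ge0.
Qed.

Lemma ler_prod_inj (R : numDomainType) (I J : finType) (P : pred J)
    (h : J -> I) (F : I -> R) :
  {in P &, injective h} -> (forall i, 0 <= F i <= 1) ->
  \prod_i F i <= \prod_(j | P j) F (h j).
Proof.
move=> inj_h F01.
have F0 (Q : pred I) : 0 <= \prod_(i | Q i) F i.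
  by apply: prodr_ge0 => i _; have /andP[] := F01 i.
rewrite -[leRHS](big_imset F inj_h) [leLHS](bigID [in h @: P]) /=.
by rewrite ler_piMr // prodr_ile1.
Qed.

Lemma leq_card_outside (D : finType) j (c : j.-tuple D) :
  (#|D| - j <= #|{: {b : D | b \notin c}}|)%N.
Proof.
have card_c : (#|c| <= j)%N by rewrite -[leqRHS](size_tuple c) card_size.
by rewrite card_sig leq_subLR -(cardC (mem c)) leq_add.
Qed.

Lemma natr_forall (R : nzSemiRingType) (J : finType) (P Q : pred J) :
  [forall (b | P b), Q b]%:R = \prod_(b | P b) (Q b)%:R :> R.
Proof.
rewrite -big_andE.
by apply: (big_morph (fun b : bool => b%:R)) => // x y; rewrite -natrM mulnb.
Qed.

Lemma prodr_1B (R : comNzRingType) (J : finType) (x : J -> R) :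
  \prod_b (1 - x b) = \sum_(B : {set J}) (-1) ^+ #|B| * \prod_(b in B) x b.
Proof.
under eq_bigr do rewrite addrC.
rewrite bigA_distr; apply: eq_big => [B|B _]; first by rewrite inE.
by rewrite -prodrN [RHS]big_mkcond.
Qed.

Section ProductWeights.
Variables (R : comNzRingType) (I X : finType) (w : I -> X -> R).
Hypothesis sum_w : forall i, \sum_a w i a = 1.
Variable t : I -> X.

Definition cylinder (U : pred I) : pred {ffun I -> X} :=
  [pred F : {ffun I -> X} | [forall (i | U i), F i == t i]].

Lemma sum_cylinder (U : pred I) :
  \sum_(F | cylinder U F) \prod_i w i (F i) = \prod_(i | U i) w i (t i).
Proof.
pose Q i := if U i then pred1 (t i) else predT.
transitivity (\prod_i \sum_(a | Q i a) w i a).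
  rewrite bigA_distr_big_dep; apply: eq_bigl => F; apply/forall_inP/familyP.
    by move=> agree i; rewrite /Q; case: ifP => // /agree.
  by move=> inQ i Ui; have := inQ i; rewrite /Q Ui.
rewrite [RHS]big_mkcond; apply: eq_bigr => i _; rewrite /Q.
by case: (U i); rewrite ?big_pred1_eq ?sum_w.
Qed.

(* Independence of the events "F agrees with t on C b", read off the
   inclusion-exclusion expansion of both sides. *)
Lemma sum_avoid_cylinders (J : finType) (C : J -> pred I) :
  (forall b b' i, C b i -> C b' i -> b = b') ->
  \sum_(F | [forall b, ~~ cylinder (C b) F]) \prod_i w i (F i) =
  \prod_b (1 - \prod_(i | C b i) w i (t i)).
Proof.
move=> disjC; pose CU (B : {set J}) i := [exists (b | b \in B), C b i].
have prod_CU (B : {set J}) (G : I -> R) :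
    \prod_(b in B) \prod_(i | C b i) G i = \prod_(i | CU B i) G i.
  rewrite (exchange_big_dep (CU B)) => [|b i bB Cbi]; last first.
    by apply/exists_inP; exists b.
  apply: eq_bigr => i /exists_inP[b bB Cbi].
  rewrite (big_pred1 b) // => b' /=; apply/andP/eqP => [[_ Cb'i]|->] //.
  exact: disjC Cb'i Cbi.
have cylinder_CU (B : {set J}) F :
    \prod_(b in B) (cylinder (C b) F)%:R = (cylinder (CU B) F)%:R :> R.
  by rewrite natr_forall -prod_CU; under eq_bigr do rewrite natr_forall.
rewrite prodr_1B big_mkcond /=.
under [RHS]eq_bigr => B _ do
  rewrite prod_CU -sum_cylinder big_mkcond mulr_sumr /=.
rewrite exchange_big; apply: eq_bigr => F _.
rewrite -mulrb -mulr_natr (natr_forall _ predT).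
have negbR (b : bool) : (~~ b)%:R = 1 - b%:R :> R.
  by case: b; rewrite ?subrr ?subr0.
under [X in _ * X]eq_bigr do rewrite negbR.
rewrite prodr_1B mulr_sumr; apply: eq_bigr => B _.
by rewrite cylinder_CU mulrCA mulr_natr mulrb.
Qed.

End ProductWeights.

Section GeometricDecay.
Variable R : realType.

Lemma natX_le_expR (c : R) k n :
  0 < c -> n%:R ^+ k.+1 <= k.+1`!%:R / c ^+ k.+1 * expR c ^+ n.
Proof.
move=> c0; rewrite mulrAC ler_pdivlMr ?exprn_gt0 // -exprMn.
rewrite [leRHS]mulrC -ler_pdivrMr ?ltr0n ?fact_gt0 // -expRM_natr.
rewrite [n%:R * c]mulrC.
have cn0 : 0 <= c * n%:R by rewrite mulr_ge0 ?ler0n ?(ltW c0).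
by apply: le_trans (expR_ge1Dxn k cn0); rewrite lerDr.
Qed.

Lemma exprB_mul_expR_le (r : R) j n :
  0 <= r <= 1 -> r ^+ (n - j) * expR (1 - r) ^+ n <= expR (1 - r) ^+ j.
Proof.
move=> /andP[r0 r1]; set e := expR _.
have e1 : 1 <= e by rewrite -expR0 ler_expR subr_ge0.
have re1 : r * e <= 1.
  rewrite -ler_pdivlMr ?expR_gt0 // mul1r -expRN opprB.
  by apply: le_trans (expR_ge1Dx _); rewrite addrC subrK.
have e0 : 0 <= e by rewrite expR_ge0.
apply: (@le_trans _ _ (r ^+ (n - j) * e ^+ (n - j + j))).
  by rewrite ler_wpM2l ?exprn_ge0 // ler_weXn2l // addnC -leq_subLR.
by rewrite exprD mulrA -exprMn ler_piMl ?exprn_ge0 // exprn_ile1 ?mulr_ge0.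
Qed.

Lemma cvg_natX_mul_exprB j (r : R) : 0 <= r < 1 ->
  (n%:R ^+ j * r ^+ (n - j)) @[n --> \oo] --> (0 : R).
Proof.
move=> /andP[r0 r1]; have c0 : 0 < 1 - r by rewrite subr_gt0.
pose C := j.+1`!%:R / (1 - r) ^+ j.+1 * expR (1 - r) ^+ j.
have C_bound n : n%:R ^+ j * r ^+ (n - j) * n%:R <= C.
  rewrite mulrAC -exprSr.
  apply: le_trans (ler_wpM2r (exprn_ge0 _ r0) (natX_le_expR j n c0)) _.
  rewrite /C -[leLHS]mulrA ler_wpM2l ?divr_ge0 ?exprn_ge0 ?(ltW c0) // mulrC.
  by apply: exprB_mul_expR_le; rewrite r0 ltW.
apply: (@squeeze_cvgr _ _ _ _ (fun=> 0) (fun n => C * n%:R^-1)).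
- near=> n; rewrite mulr_ge0 ?exprn_ge0 //= ler_pdivlMr ?C_bound // ltr0n.
  by near: n; exact: nbhs_infty_gt.
- exact: cvg_cst.
- rewrite -[X in _ --> X](mulr0 C); apply: cvgMl_tmp.
  by rewrite -cvg_shiftS; exact: cvg_harmonic.
Unshelve. all: by end_near. Qed.

End GeometricDecay.

Section GroundAtoms.
Variable tau : finVocabulary.

Definition ground_atom (D : finType) : finType :=
  {S : tau & (voc_arity S).-tuple D}.

Definition atom_args (D : finType) (u : ground_atom D) : seq D := tagged u.

Definition map_atom (D E : finType) (h : D -> E) (u : ground_atom D) :
    ground_atom E :=
  Tagged (fun S => (voc_arity S).-tuple E) [tuple of map h (tagged u)].

Lemma atom_args_nonempty (D : finType) (u : ground_atom D) :
  exists z, z \in atom_args u.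
Proof.
by exists (tnth (tagged u) (Ordinal (voc_arity_gt0 (tag u)))); exact: mem_tnth.
Qed.

Lemma eq_in_map_atom (D E : finType) (g h : D -> E) u :
  {in atom_args u, g =1 h} -> map_atom g u = map_atom h u.
Proof.
by move=> gh; congr (Tagged _ _); apply: val_inj; apply/eq_in_map.
Qed.

Lemma map_atom_id_in (D : finType) (h : D -> D) u :
  {in atom_args u, h =1 id} -> map_atom h u = u.
Proof.
move/eq_in_map_atom->; case: u => S x; congr (Tagged _ _).
by apply: val_inj; rewrite /= map_id.
Qed.

Lemma map_atom_comp (D E F : finType) (h : D -> E) (g : E -> F) u :
  map_atom (g \o h) u = map_atom g (map_atom h u).
Proof. by congr (Tagged _ _); apply: val_inj; rewrite /= map_comp. Qed.

Lemma map_atom_onto (D E : finType) (h : D -> E) (u : ground_atom E) :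
  {subset atom_args u <= codom h} -> exists v, u = map_atom h v.
Proof.
move=> hu.
have [i | y hy] := fin_all_exists (P := fun i z => tnth (tagged u) i = h z).
  by have /codomP := hu _ (mem_tnth i (tagged u)).
exists (Tagged (fun S => (voc_arity S).-tuple D) [tuple y i | i < _]).
case: u {hu} y hy => S x /= y hy; congr (Tagged _ _).
by apply: eq_from_tnth => i; rewrite tnth_map tnth_mktuple.
Qed.

End GroundAtoms.

Notation atom_valuation A tau D := {ffun ground_atom tau D -> A}.

Section NewAtoms.
Variables (tau : finVocabulary) (D : finType) (j : nat) (c : j.-tuple D).

(* Points outside [c] all get the last position [j]. *)
Definition position (z : D) : 'I_j.+1 := inord (index z c).

Definition at_position (b : D) (i : 'I_j.+1) : D := nth b c i.

Lemma positionE z : position z = index z c :> nat.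
Proof. by rewrite inordK // ltnS -[leqRHS](size_tuple c) index_size. Qed.

Lemma positionK b : {in b :: c, cancel position (at_position b)}.
Proof.
move=> z; rewrite inE /at_position positionE; have [zc _|zc] := boolP (z \in c).
  exact: nth_index.
by rewrite orbF => /eqP<-; rewrite nth_default // leqNgt index_mem.
Qed.

Definition new_atom (b : D) (u : ground_atom tau D) : bool :=
  (b \in atom_args u) && all [in b :: c] (atom_args u).

Lemma new_atom_inj b b' u :
  b \notin c -> new_atom b u -> new_atom b' u -> b = b'.
Proof.
move=> /negPf bc /andP[bu _] /andP[_ /allP/(_ _ bu)].
by rewrite inE bc orbF => /eqP.
Qed.

Lemma map_position_inj b : {in new_atom b &, injective (map_atom position)}.
Proof.
apply: (can_in_inj (g := map_atom (at_position b))) => u /andP[_ /allP bc].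
rewrite -map_atom_comp; apply: map_atom_id_in => z /bc.
exact: positionK.
Qed.

End NewAtoms.

Section Saturation.
Variables (d : Order.disp_t) (A : finLatticeAlgebra d) (tau : finVocabulary).

Definition diagram (D : finType) (M : structure A tau D) :
    atom_valuation A tau D :=
  [ffun u => M (tag u) (tagged u)].

(* [T] prescribes the values of the ground atoms that mention a new point [b],
   the arguments being given by their positions in [c], with [j] for [b]; its
   other values are irrelevant. *)
Definition realized_by (D : finType) (M : structure A tau D) j (c : j.-tuple D)
    (T : atom_valuation A tau 'I_j.+1) (b : D) : bool :=
  [forall (u | new_atom c b u), diagram M u == T (map_atom (position c) u)].

Definition realized (D : finType) (M : structure A tau D) j (c : j.-tuple D)
    (T : atom_valuation A tau 'I_j.+1) : bool :=
  [exists b : {b | b \notin c}, realized_by M c T (val b)].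

Definition saturated K (D : finType) (M : structure A tau D) : bool :=
  [forall j : 'I_K, forall c : j.-tuple D, forall T, realized M c T].

Lemma saturatedP K (D : finType) (M : structure A tau D) j (c : j.-tuple D) T :
  saturated K M -> (j < K)%N -> exists2 b, b \notin c & realized_by M c T b.
Proof.
move=> satM jK; move/forallP: satM => /(_ (Ordinal jK)) /forallP/(_ c).
by move=> /forallP/(_ T) /existsP[b bT]; exists (val b); first exact: (valP b).
Qed.

Section PartialIsomorphism.
Variables (D E : finType) (M : structure A tau D) (N : structure A tau E).

Definition partial_iso k (m : k.-tuple D) (m' : k.-tuple E) : Prop :=
  (forall i i', (tnth m i == tnth m i') = (tnth m' i == tnth m' i')) /\
  (forall u, diagram M (map_atom (tnth m) u) =
             diagram N (map_atom (tnth m') u)).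

Lemma partial_iso0 : partial_iso [tuple] [tuple].
Proof. by split=> [[]|u] //; have [[]] := atom_args_nonempty u. Qed.

Lemma partial_iso_index k (m : k.-tuple D) (m' : k.-tuple E) i :
  partial_iso m m' -> index (tnth m i) m = index (tnth m' i) m'.
Proof.
have indexE (X : eqType) (t : k.-tuple X) x :
    index x t = find (fun i' => tnth t i' == x) (enum 'I_k).
  by rewrite -[in LHS](map_tnth_enum t) /index find_map.
by case=> eq_mm' _; rewrite !indexE; apply: eq_find => i'; exact: eq_mm'.
Qed.

Lemma partial_iso_cons_mem k (m : k.-tuple D) (m' : k.-tuple E) i :
  partial_iso m m' ->
  partial_iso [tuple of tnth m i :: m] [tuple of tnth m' i :: m'].
Proof.
pose s i' := oapp id i (unlift ord0 i').
have consE (X : Type) (t : k.-tuple X) :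
    tnth [tuple of tnth t i :: t] =1 tnth t \o s.
  by move=> i' /=; rewrite /s; case: unliftP => [x|] ->; rewrite ?tnthS ?tnth0.
case=> eq_mm' diag_mm'; split=> [x x'|u]; first by rewrite !consE eq_mm'.
by rewrite !(eq_in_map_atom (in1W (consE _ _))) !map_atom_comp.
Qed.

Lemma partial_iso_cons_new k (m : k.-tuple D) (m' : k.-tuple E) b b' :
  partial_iso m m' -> b \notin m -> b' \notin m' ->
  realized_by N m' (finfun (diagram M \o map_atom (at_position m b))) b' ->
  partial_iso [tuple of b :: m] [tuple of b' :: m'].
Proof.
move=> iso bm b'm' /forall_inP new_eq; have [eq_mm' diag_mm'] := iso.
split=> [x x'|u].
  have bmF i : (tnth m i == b) = false by exact: tnth_eqF.
  have b'm'F i : (tnth m' i == b') = false by exact: tnth_eqF.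
  by case: (unliftP ord0 x) => [i|] ->; case: (unliftP ord0 x') => [i'|] ->;
    rewrite ?tnthS ?tnth0 ?eqxx ?(eq_sym b) ?(eq_sym b') ?bmF ?b'm'F ?eq_mm'.
have [new|old] := boolP (ord0 \in atom_args u); last first.
  have [|v ->] := @map_atom_onto _ _ _ (lift ord0) u.
    move=> x xu; case: (unliftP ord0 x) => [i|] x0; first by rewrite x0 codom_f.
    by rewrite -x0 xu in old.
  rewrite -!map_atom_comp.
  rewrite !(eq_in_map_atom (in1W (fun i => tnthS _ _ i : _ = tnth _ i))).
  exact: diag_mm'.
have /new_eq/eqP -> : new_atom m' b' (map_atom (tnth [tuple of b' :: m']) u).
  apply/andP; split; first by apply/mapP; exists ord0; rewrite ?tnth0.
  by apply/allP => _ /mapP[i _ ->]; exact: mem_tnth.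
rewrite [RHS]ffunE /= -!map_atom_comp; congr (diagram M _).
apply/eq_in_map_atom => x _ /=; rewrite /at_position positionE.
case: (unliftP ord0 x) => [i|] ->; rewrite ?tnthS ?tnth0.
  by rewrite -(partial_iso_index i iso) nth_index ?mem_tnth.
by rewrite nth_default // memNindex ?size_tuple.
Qed.

Lemma partial_iso_forth K k (m : k.-tuple D) (m' : k.-tuple E) b :
  saturated K N -> (k < K)%N -> partial_iso m m' ->
  exists b', partial_iso [tuple of b :: m] [tuple of b' :: m'].
Proof.
move=> satN kK iso; have [/tnthP[i ->]|bm] := boolP (b \in m).
  by exists (tnth m' i); exact: partial_iso_cons_mem.
have [b' b'm' b'T] :=
  saturatedP m' (finfun (diagram M \o map_atom (at_position m b))) satN kK.
by exists b'; exact: partial_iso_cons_new b'T.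
Qed.

End PartialIsomorphism.

Lemma partial_iso_sym (D E : finType) (M : structure A tau D)
    (N : structure A tau E) k (m : k.-tuple D) (m' : k.-tuple E) :
  partial_iso M N m m' -> partial_iso N M m' m.
Proof. by case=> eq_mm' diag_mm'; split. Qed.

Fixpoint qrank k (f : formula A tau k) : nat :=
  match f with
  | Atom _ _ _ => 0
  | And _ f g => maxn (qrank f) (qrank g)
  | Or _ f g => maxn (qrank f) (qrank g)
  | Op _ _ f => \max_i qrank (f i)
  | Forall _ f => (qrank f).+1
  | Exists _ f => (qrank f).+1
  end.

Definition iso_invariant K k (f : formula A tau k) : Prop :=
  forall (D E : finType) (M : structure A tau D) (N : structure A tau E)
    (m : k.-tuple D) (m' : k.-tuple E),
  saturated K M -> saturated K N -> partial_iso M N m m' ->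
  (qrank f + k <= K)%N -> value M f m = value N f m'.

Lemma iso_invariant_codom_sub K k (f : formula A tau k.+1) (D E : finType)
    (M : structure A tau D) (N : structure A tau E)
    (m : k.-tuple D) (m' : k.-tuple E) :
  iso_invariant K f -> saturated K M -> saturated K N -> partial_iso M N m m' ->
  ((qrank f).+1 + k <= K)%N ->
  {subset codom (fun b => value M f [tuple of b :: m])
       <= codom (fun b' => value N f [tuple of b' :: m'])}.
Proof.
move=> inv_f satM satN iso; rewrite addSnnS => rank_le _ /codomP[b ->].
have kK : (k < K)%N by apply: leq_trans rank_le; rewrite leq_addl.
have [b' iso_b] := partial_iso_forth b satN kK iso.
by apply/codomP; exists b'; exact: inv_f.
Qed.

Lemma iso_invariant_codom K k (f : formula A tau k.+1) (D E : finType)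
    (M : structure A tau D) (N : structure A tau E)
    (m : k.-tuple D) (m' : k.-tuple E) :
  iso_invariant K f -> saturated K M -> saturated K N -> partial_iso M N m m' ->
  ((qrank f).+1 + k <= K)%N ->
  codom (fun b => value M f [tuple of b :: m]) =i
  codom (fun b' => value N f [tuple of b' :: m']).
Proof.
move=> inv_f satM satN iso rank_le a.
by apply/idP/idP; apply: iso_invariant_codom_sub inv_f _ _ _ rank_le a => //;
  exact: partial_iso_sym.
Qed.

Lemma saturated_iso_invariant K k (f : formula A tau k) : iso_invariant K f.
Proof.
elim: f => {k} [k S x|k f IHf g IHg|k f IHf g IHg|k o f IHf|k f IHf|k f IHf]
  D E M N m m' satM satN iso /=.
- have [_ /(_ (Tagged (fun S => (voc_arity S).-tuple 'I_k) x))] := iso.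
  by rewrite !ffunE.
- rewrite addn_maxl geq_max => /andP[f_le g_le].
  by rewrite (IHf _ _ M N m m') // (IHg _ _ M N m m').
- rewrite addn_maxl geq_max => /andP[f_le g_le].
  by rewrite (IHf _ _ M N m m') // (IHg _ _ M N m m').
- move=> rank_le; congr la_fun; apply: eq_mktuple => i; apply: IHf => //.
  apply: leq_trans rank_le; rewrite leq_add2r.
  exact: (@leq_bigmax _ (fun i => qrank (f i))).
- move=> rank_le; apply: eq_big_codom; first exact: meetxx.
  exact: iso_invariant_codom IHf satM satN iso rank_le.
- move=> rank_le; apply: eq_big_codom; first exact: joinxx.
  exact: iso_invariant_codom IHf satM satN iso rank_le.
Qed.

Lemma eq_value_saturated (phi : sentence A tau) (D E : finType)
    (M : structure A tau D) (N : structure A tau E) :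
  saturated (qrank phi) M -> saturated (qrank phi) N ->
  value M phi [tuple] = value N phi [tuple].
Proof.
move=> satM satN; apply: saturated_iso_invariant satM satN _ _.
  exact: partial_iso0.
by rewrite addn0.
Qed.

End Saturation.

Section RandomStructure.
Variables (R : realType) (d : Order.disp_t) (A : finLatticeAlgebra d).
Variables (tau : finVocabulary) (p : tau -> A -> R).
Hypothesis p_distr : forall S : tau, is_distribution (p S).

Lemma p_ge0_le1 S a : 0 <= p S a <= 1.
Proof. by have [->] := p_distr S. Qed.

Lemma sum_p S : \sum_a p S a = 1.
Proof. by have [] := p_distr S. Qed.

Lemma prod_p_ge0_le1 (D : finType) (U : pred (ground_atom tau D))
    (F : ground_atom tau D -> A) :
  0 <= \prod_(u | U u) p (tag u) (F u) <= 1.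
Proof.
rewrite prodr_ile1 ?andbT => [|u _]; last exact: p_ge0_le1.
by apply: prodr_ge0 => u _; have /andP[] := p_ge0_le1 (tag u) (F u).
Qed.

Definition diagram_prob (D : finType) (T : atom_valuation A tau D) : R :=
  \prod_u p (tag u) (T u).

Definition event_prob n (P : pred (structure A tau 'I_n)) : R :=
  \sum_(M | P M) prob p M.

Lemma diagram_bij (D : finType) : bijective (@diagram d A tau D).
Proof.
exists (fun F : atom_valuation A tau D =>
    [ffun S : tau => [ffun x : (voc_arity S).-tuple D =>
      F (Tagged (fun S => (voc_arity S).-tuple D) x)]]) => [M|F].
  by apply/ffunP => S; apply/ffunP => x; rewrite !ffunE.
by apply/ffunP => -[S x]; rewrite !ffunE.
Qed.

Lemma prob_diagram n (M : structure A tau 'I_n) :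
  prob p M = diagram_prob (diagram M).
Proof.
by rewrite /prob sig_big_dep; apply: eq_bigr => u _; rewrite [diagram M u]ffunE.
Qed.

Lemma event_prob_diagram n (Q : pred (atom_valuation A tau 'I_n)) :
  event_prob [pred M | Q (diagram M)] = \sum_(F | Q F) diagram_prob F.
Proof.
rewrite (reindex _ (onW_bij _ (diagram_bij _))).
by apply: eq_bigr => M _; exact: prob_diagram.
Qed.

Lemma prob_ge0 n (M : structure A tau 'I_n) : 0 <= prob p M.
Proof.
by rewrite prob_diagram; have /andP[] := prod_p_ge0_le1 predT (diagram M).
Qed.

Lemma event_prob_ge0 n P : 0 <= @event_prob n P.
Proof. by apply: sumr_ge0 => M _; exact: prob_ge0. Qed.

Lemma sub_event_prob n (P Q : pred (structure A tau 'I_n)) :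
  (forall M, P M -> Q M) -> event_prob P <= event_prob Q.
Proof.
move=> PQ; rewrite /event_prob [leRHS](bigID P) /=.
rewrite [X in _ <= X + _](eq_bigl P) ?lerDl ?event_prob_ge0 // => M.
by case PM: (P M); rewrite ?andbT ?andbF ?PQ.
Qed.

Lemma event_prob_not_forall_le n (I : finType)
    (Q : I -> pred (structure A tau 'I_n)) :
  event_prob [pred M | ~~ [forall i, Q i M]] <=
  \sum_i event_prob [pred M | ~~ Q i M].
Proof. by apply: sum_not_forall_le => M; exact: prob_ge0. Qed.

Lemma event_probT n : @event_prob n predT = 1.
Proof.
rewrite (event_prob_diagram predT).
rewrite -(bigA_distr_bigA (fun (u : ground_atom tau 'I_n) a => p (tag u) a)).
by rewrite big1 // => u _; exact: sum_p.
Qed.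

Lemma event_prob_le1 n P : @event_prob n P <= 1.
Proof. by rewrite -(event_probT n); exact: sub_event_prob. Qed.

Lemma event_probC n P : @event_prob n [pred M | ~~ P M] = 1 - event_prob P.
Proof.
rewrite -(event_probT n) /event_prob [X in _ = X - _](bigID P) /=.
by rewrite addrAC subrr add0r.
Qed.

Lemma diagram_prob_le_new (D : finType) j (c : j.-tuple D)
    (T : atom_valuation A tau 'I_j.+1) b :
  diagram_prob T <=
  \prod_(u | new_atom c b u) p (tag u) (T (map_atom (position c) u)).
Proof.
apply: (ler_prod_inj (h := map_atom (position c))
  (F := fun v => p (tag v) (T v))) => [|v]; last exact: p_ge0_le1.
exact: map_position_inj.
Qed.

(* Distinct new points have disjoint sets of new atoms, so they realize [T]
   independently. *)
Lemma event_prob_not_realized_le n j (c : j.-tuple 'I_n)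
    (T : atom_valuation A tau 'I_j.+1) :
  event_prob [pred M | ~~ realized M c T] <= (1 - diagram_prob T) ^+ (n - j).
Proof.
pose t u := T (map_atom (position c) u).
pose new (b : {b | b \notin c}) := new_atom (tau := tau) c (val b).
have -> : event_prob [pred M | ~~ realized M c T] =
    \prod_b (1 - \prod_(u | new b u) p (tag u) (t u)).
  rewrite -(sum_avoid_cylinders (fun u => sum_p (tag u))); last first.
    move=> b b' u bu b'u; apply: val_inj.
    exact: new_atom_inj (valP b) bu b'u.
  by rewrite -event_prob_diagram; apply: eq_bigl => M; rewrite inE negb_exists.
apply: (@le_trans _ _ (\prod_(b : {b | b \notin c}) (1 - diagram_prob T))).
  apply: ler_prod => b _; have /andP[_ new_le1] := prod_p_ge0_le1 (new b) t.
  by rewrite subr_ge0 new_le1 lerD2l lerN2 diagram_prob_le_new.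
have /andP[T_ge0 T_le1] := prod_p_ge0_le1 predT T.
rewrite prodr_const ler_wiXn2l ?subr_ge0 ?lerBlDr ?lerDl //.
by rewrite -{1}(card_ord n) leq_card_outside.
Qed.

Lemma event_prob_not_saturated_le K n :
  event_prob [pred M : structure A tau 'I_n | ~~ saturated K M] <=
  \sum_(j < K) \sum_(T : atom_valuation A tau 'I_j.+1)
    n%:R ^+ j * (1 - diagram_prob T) ^+ (n - j).
Proof.
apply: le_trans (event_prob_not_forall_le _) _; apply: ler_sum => j _.
rewrite -mulr_sumr; set e := \sum_T _.
have -> : n%:R ^+ j * e = \sum_(c : j.-tuple 'I_n) e.
  by rewrite sumr_const card_tuple card_ord -[RHS]mulr_natl natrX.
apply: le_trans (event_prob_not_forall_le _) _; apply: ler_sum => c _.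
apply: le_trans (event_prob_not_forall_le _) _; apply: ler_sum => T _.
exact: event_prob_not_realized_le.
Qed.

End RandomStructure.

Section ZeroOneLaw.
Variables (R : realType) (d : Order.disp_t) (A : finLatticeAlgebra d).
Variables (tau : finVocabulary) (p : tau -> A -> R).
Hypothesis p_distr : forall S : tau, is_distribution (p S).
Hypothesis p_gt0 : forall (S : tau) (a : A), 0 < p S a.

Lemma cvg_event_prob_not_saturated K :
  event_prob p [pred M : structure A tau 'I_n | ~~ saturated K M]
    @[n --> \oo] --> (0 : R).
Proof.
have cvg_sum0 (I : finType) (f : I -> nat -> R) :
    (forall i, f i n @[n --> \oo] --> (0 : R)) ->
    \sum_i f i n @[n --> \oo] --> (0 : R).
  move=> f0.
  rewrite -[X in _ --> X](_ : \sum_(i : I) 0 = 0); last by rewrite big1.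
  by apply: cvg_big => [|i _]; [exact: add_continuous | exact: f0].
apply: (@squeeze_cvgr _ _ _ _ (fun=> 0) (fun n => \sum_(j < K)
    \sum_(T : atom_valuation A tau 'I_j.+1)
      n%:R ^+ j * (1 - diagram_prob p T) ^+ (n - j))).
- by apply: nearW => n; rewrite event_prob_ge0 ?event_prob_not_saturated_le.
- exact: cvg_cst.
- apply: (cvg_sum0) => j; apply: cvg_sum0 => T; apply: cvg_natX_mul_exprB.
  have /andP[_ T_le1] := prod_p_ge0_le1 p_distr predT T.
  by rewrite subr_ge0 T_le1 ltrBlDr ltrDl prodr_gt0.
Qed.

Lemma cvg_event_prob_saturated K :
  event_prob p [pred M : structure A tau 'I_n | saturated K M]
    @[n --> \oo] --> (1 : R).
Proof.
have satE n : event_prob p [pred M : structure A tau 'I_n | saturated K M] =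
    1 - event_prob p [pred M : structure A tau 'I_n | ~~ saturated K M].
  by rewrite event_probC // subKr.
rewrite (funext satE) -[X in _ --> X]subr0; apply: cvgB; first exact: cvg_cst.
exact: cvg_event_prob_not_saturated.
Qed.

Lemma exists_saturated K :
  exists n (M : structure A tau 'I_n), saturated K M.
Proof.
have [n _ /(_ n (leqnn n)) sat_gt0] :=
  cvgr_gt _ (cvg_event_prob_saturated K) _ ltr01.
exists n; apply/existsP; apply: contraTT sat_gt0.
rewrite negb_exists -leNgt => /forallP unsat.
by rewrite /event_prob big_pred0 // => M; exact/negbTE/unsat.
Qed.

Lemma exists_cvg_mu1 (phi : sentence A tau) :
  exists a, mu p n phi a @[n --> \oo] --> (1 : R).
Proof.
have [n0 [M0 satM0]] := exists_saturated (qrank phi).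
exists (value M0 phi [tuple]).
apply: (@squeeze_cvgr _ _ _ _ (fun n => event_prob p
  [pred M : structure A tau 'I_n | saturated (qrank phi) M]) (fun=> 1)).
- apply: nearW => n; rewrite event_prob_le1 // andbT.
  by apply: sub_event_prob => // M satM; exact/eqP/eq_value_saturated.
- exact: cvg_event_prob_saturated.
- exact: cvg_cst.
Qed.

Lemma cvg_mu0_neq (phi : sentence A tau) a b : b != a ->
  mu p n phi a @[n --> \oo] --> (1 : R) ->
  mu p n phi b @[n --> \oo] --> (0 : R).
Proof.
move=> ba mu1; apply: (@squeeze_cvgr _ _ _ _ (fun=> 0)
  (fun n => 1 - mu p n phi a)).
- apply: nearW => n; rewrite event_prob_ge0 // -event_probC //.
  by apply: sub_event_prob => // M /eqP /= ->.
- exact: cvg_cst.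
- by rewrite -[X in _ --> X](subrr (1 : R)); apply: cvgB mu1; exact: cvg_cst.
Qed.

End ZeroOneLaw.

Theorem theorem3p1 (R : realType) (d : Order.disp_t) (A : finLatticeAlgebra d)
    (tau : finVocabulary) (p : tau -> A -> R)
    (p_distr : forall S : tau, is_distribution (p S))
    (p_gt0 : forall (S : tau) (a : A), 0 < p S a)
    (phi : sentence A tau) :
  (forall a : A, (mu p n phi a @[n --> \oo] --> (1 : R)) \/
                 (mu p n phi a @[n --> \oo] --> (0 : R))) /\
  (exists! a : A, mu p n phi a @[n --> \oo] --> (1 : R)).
Proof.
have [a0 mu1] := exists_cvg_mu1 p_distr p_gt0 phi.
have mu0 a : a != a0 -> mu p n phi a @[n --> \oo] --> (0 : R).
  by move=> aa0; exact: cvg_mu0_neq aa0 mu1.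
split=> [a|]; first by have [->|/mu0] := eqVneq a a0; [left | right].
exists a0; split=> // a mua1; apply/eqP; rewrite eq_sym.
apply: contraT => /mu0 mua0; case/eqP: (oner_neq0 R).
exact: (cvg_unique (@Rhausdorff R) mua1 mua0).
Qed.
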